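(* Let $(\{(G_\sigma, d_\sigma)\}_{\sigma \in \Sigma}, \{\alpha_{\sigma}^{\tau} \colon G_\sigma \to G_\tau\}_{\sigma \leqslant \tau})$ be a direct system, indexed by an upward directed set $\Sigma$, in the category of compact metric groups with non-expansive homomorphisms as arrows, and assume that $\alpha_\sigma^\tau$ is surjective for all $\sigma \leqslant \tau$. Then this system has an inductive limit in this category. Furthermore, (1) the object of the inductive limit does not depend, up to isometric isomorphism, on the choice of surjective arrows for the system: if $(\{(G_\sigma, d_\sigma)\}_{\sigma \in \Sigma}, \{\beta_{\sigma}^{\tau}\}_{\sigma \leqslant \tau})$ is another direct system in this category over the same $\Sigma$ with the same objects and with all arrows surjective, then the objects of the inductive limits of the two systems are isometrically isomorphic; (2) the arrows of the inductive limit are surjective.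
   Context: A metric group is a metrizable topological group $G$ together with a fixed left-invariant metric $d$ inducing its topology (no right-invariance is required). A mapping $f\colon (X,d)\to(Y,\varrho)$ is non-expansive if $\varrho(f(x),f(y))\leqslant d(x,y)$ for all $x,y\in X$. A direct system in a category $\mathsf A$ indexed by an upward directed set $\Sigma$ is a family of objects $\{A_\sigma\}_{\sigma\in\Sigma}$ with morphisms $\{\alpha_\sigma^\tau\colon A_\sigma\to A_\tau\}_{\sigma\leqslant\tau}$ such that $\alpha_\sigma^\sigma=\mathrm{id}_{A_\sigma}$ and $\alpha_\varrho^\tau\circ\alpha_\sigma^\varrho=\alpha_\sigma^\tau$ for $\sigma\leqslant\varrho\leqslant\tau$. Its inductive limit is an object $A$ of $\mathsf A$ with morphisms $\{\alpha_\sigma\colon A_\sigma\to A\}_{\sigma\in\Sigma}$ such that $\alpha_\tau\circ\alpha_\sigma^\tau=\alpha_\sigma$ for $\sigma\leqslant\tau$, and such that for every object $A'$ and morphisms $\{\xi_\sigma\colon A_\sigma\to A'\}_{\sigma\in\Sigma}$ with $\xi_\tau\circ\alpha_\sigma^\tau=\xi_\sigma$ for $\sigma\leqslant\tau$ there is a unique morphism $\nu\colon A\to A'$ with $\nu\circ\alpha_\sigma=\xi_\sigma$ for all $\sigma\in\Sigma$. *)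

(* Defs.v *)
From HB Require Import structures.
From mathcomp Require Import all_boot all_order all_algebra.
From mathcomp Require Import all_classical all_reals all_analysis.

Set Implicit Arguments.
Unset Strict Implicit.
Unset Printing Implicit Defensive.

Import Order.TTheory GRing.Theory Num.Theory.

Local Open Scope classical_set_scope.
Local Open Scope ring_scope.

(* [metricType] already guarantees that the topology is the one of [mdist]. *)
HB.mixin Record isMetricGroup (R : realType) G of Metric R G & Group G := {
  mulg_continuous : continuous (fun xy : G * G => (xy.1 * xy.2)%g) ;
  invg_continuous : continuous (fun x : G => (x^-1)%g) ;
  mdist_mulgl : forall z x y : G,
    mdist (z * x)%g (z * y)%g = mdist x y
}.

#[short(type="metricGroupType")]
HB.structure Definition MetricGroup (R : realType) :=
  { G of Metric R G & Group G & isMetricGroup R G }.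

HB.mixin Record MetricGroup_isCompact (R : realType) G of MetricGroup R G := {
  metric_group_compact : compact [set: G]
}.

#[short(type="compactMetricGroupType")]
HB.structure Definition CompactMetricGroup (R : realType) :=
  { G of MetricGroup R G & MetricGroup_isCompact R G }.

Definition non_expansive (R : realType) (X Y : metricType R) (f : X -> Y) :=
  forall x y, mdist (f x) (f y) <= mdist x y.

Definition group_hom (G H : groupType) (f : G -> H) :=
  {morph f : x y / (x * y)%g >-> (x * y)%g}.

Definition non_expansive_hom (R : realType) (G H : compactMetricGroupType R)
    (f : G -> H) :=
  group_hom f /\ non_expansive f.

Definition isometrically_isomorphic (R : realType) (G H : metricGroupType R) :=
  exists f : G -> H, [/\ group_hom f, bijective f &
    forall x y, mdist (f x) (f y) = mdist x y].

(* Neither antisymmetry nor nonemptiness is required of a directed set. *)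
Definition upward_directed (d : Order.disp_t) (S : preorderType d) :=
  forall s t : S, exists u : S, (s <= u)%O /\ (t <= u)%O.

Section DirectSystems.
Variables (R : realType) (d : Order.disp_t) (S : preorderType d).
Variable G : S -> compactMetricGroupType R.

(* The order proofs are boolean equalities, hence the arrow from [G s] to
   [G t] does not depend on the proof of [s <= t]. *)
Definition arrows := forall s t : S, (s <= t)%O -> G s -> G t.

Definition direct_system (alpha : arrows) :=
  [/\ forall s t (st : (s <= t)%O), non_expansive_hom (alpha s t st),
      forall s (ss : (s <= s)%O), alpha s s ss = id
    & forall s r t (sr : (s <= r)%O) (rt : (r <= t)%O) (st : (s <= t)%O),
        alpha r t rt \o alpha s r sr = alpha s t st].

Definition surjective_arrows (alpha : arrows) :=
  forall s t (st : (s <= t)%O), set_surj setT setT (alpha s t st).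

Definition cocone (alpha : arrows) (A : compactMetricGroupType R)
    (a : forall s, G s -> A) :=
  (forall s, non_expansive_hom (a s)) /\
  (forall s t (st : (s <= t)%O), a t \o alpha s t st = a s).

Definition inductive_limit (alpha : arrows) (A : compactMetricGroupType R)
    (a : forall s, G s -> A) :=
  cocone alpha a /\
  forall (A' : compactMetricGroupType R) (xi : forall s, G s -> A'),
    cocone alpha xi ->
    exists! nu : A -> A',
      non_expansive_hom nu /\ (forall s, nu \o a s = xi s).

End DirectSystems.

(* Main.v *)
Require Import Defs.
From HB Require Import structures.
From mathcomp Require Import all_boot all_order all_algebra.
From mathcomp Require Import all_classical all_reals all_analysis.

(** The limit is the universal target of the system.  Fix an index [s0].  A
cocone [xi] is determined by its component [xi s0], because any element of
[G s] has, for some [u] above [s] and [s0], the same image in [G u] as some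
element of [G s0].  The supremum, over all cocones [xi], of the distances
[mdist (xi s0 x) (xi s0 y)] is therefore a pseudometric on [G s0] that should
be the distance between the classes of [x] and [y] in the limit.  It is
left-invariant and below the metric of [G s0], and its kernel is an
intersection of kernels of homomorphisms, hence a closed normal subgroup.
Dividing [G s0] by this kernel ([quotient_by_pseudometric]) gives the limit
([surjective_inductive_limit_exists]): every cocone factors through the
quotient by a non-expansive map because its distances are among those in the
supremum.  The infimum of the metrics of the [G t] along the system would not
do instead: its kernel need not be normal.

The arrows into this limit are surjective, and limits are unique up to
isomorphism, so the arrows into any limit are surjective.

For the independence of the arrows, let [A] and [B] be limits of systems
[alpha] and [beta] on the same groups, with arrows [b t : G t -> B].  The maps
[b t \o alpha s t] from [G s] to [B] are surjective non-expansive
homomorphisms; by compactness they have a pointwise limit along an ultrafilter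
of indices [t] that contains all final segments.  These limits form a cocone
of surjections under [alpha], which yields a surjective non-expansive
homomorphism from [A] to [B] ([surjection_from_limit]), and likewise one from
[B] to [A].  Their composite is a surjective non-expansive self-map of a
compact metric space, hence an isometry
([surjective_non_expansive_isometry]), so both factors are isometries.

A directed set may be empty here.  The limit is then the trivial group, and
two systems on it coincide, so uniqueness of limits is enough. *)

Set Implicit Arguments.
Unset Strict Implicit.
Unset Printing Implicit Defensive.

Import Order.TTheory GRing.Theory Num.Theory.

Local Open Scope classical_set_scope.
Local Open Scope ring_scope.

(** * Non-expansive maps and limits in compact metric spaces *)

Lemma surjective_section (T U : Type) (f : T -> U) :
  set_surj setT setT f -> exists g, cancel g f.
Proof.
move=> sf; exists (fun z => projT1 (cid2 (sf z I))) => z.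
by case: cid2.
Qed.

Section MetricLimits.
Variable R : realType.
Implicit Types X Y : metricType R.

Lemma mdist_cvgP (T : Type) (F : set_system T) (FF : Filter F) X
    (f : T -> X) (p : X) :
  f @ F --> p <-> forall e, 0 < e -> \forall t \near F, mdist p (f t) < e.
Proof. exact: metricType_numDomainType.cvgrPdist_lt. Qed.

Lemma mdist_limit_le (T : Type) (F : set_system T) (FF : ProperFilter F) X
    (f g : T -> X) (p q : X) (r : R) :
  f @ F --> p -> g @ F --> q -> (\forall t \near F, mdist (f t) (g t) <= r) ->
  mdist p q <= r.
Proof.
move=> /mdist_cvgP fp /mdist_cvgP gq fg; apply/ler_addgt0Pr => e e0.
have e20 : 0 < e / 2 by rewrite divr_gt0.
have [t [[pf qg] fgr]] := filter_ex (filterI (filterI (fp _ e20) (gq _ e20)) fg).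
apply: le_trans (metric_triangle _ (f t) _) _.
rewrite [e]splitr addrCA; apply: lerD; first exact: ltW.
apply: le_trans (metric_triangle _ (g t) _) _.
by apply: lerD => //; rewrite metric_sym ltW.
Qed.

Lemma continuous_mdistP X Y (f : X -> Y) :
  continuous f <->
  forall x e, 0 < e -> \forall y \near x, mdist (f x) (f y) < e.
Proof.
by split=> fc x; [apply/(mdist_cvgP (nbhs_filter x)) | apply/mdist_cvgP];
  exact: fc.
Qed.

Lemma non_expansive_continuous X Y (f : X -> Y) :
  non_expansive f -> continuous f.
Proof.
move=> nf; apply/continuous_mdistP => x e e0.
have /continuous_mdistP/(_ x e e0) : continuous (@id X) by move=> ?; exact: cvg_id.
by apply: filterS => y; exact/le_lt_trans.
Qed.

(** A continuous surjection from a compact space to a Hausdorff space is closed,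
hence a quotient map. *)
Lemma continuous_factor (X Y Z : topologicalType) (p : X -> Y) (g : Y -> Z) :
  compact [set: X] -> hausdorff_space Y -> continuous p ->
  set_surj setT setT p -> continuous (g \o p) -> continuous g.
Proof.
move=> cX hY cp sp /continuous_closedP cgp; apply/continuous_closedP => C /cgp.
move=> clC; have -> : g @^-1` C = p @` ((g \o p) @^-1` C).
  apply/seteqP; split => [y Cy|_ [x Cx <-]//].
  by have [x _ xy] := sp y I; exists x => //=; rewrite xy.
apply: compact_closed => //; apply: continuous_compact.
  exact: continuous_subspaceT.
by apply: subclosed_compact cX _.
Qed.

Lemma ultrafilter_limit (T : Type) (U : set_system T) (X : topologicalType)
    (f : T -> X) :
  UltraFilter U -> compact [set: X] -> exists p : X, f @ U --> p.
Proof.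
move=> UU cX; have [p [_ clp]] : [set: X] `&` cluster (f @ U) !=set0.
  by apply: cX; exact: filterT.
exists p => B Bp; have [//|UB] := in_ultra_setVsetC (f @^-1` B) UU.
by have [x []] := clp (~` B) B UB Bp.
Qed.

(** Choose backward orbits of [x] and [y] under [f], prolonged by one forward
step: [s z 0 = f z], [s z 1 = z] and [f (s z k.+1) = s z k].  By compactness
two terms with indices [m < n] are close, simultaneously for [x] and [y];
applying [f] [m] times, the terms of index [0] and [k.+1], where
[k.+1 = n - m], are close.  Distances between the two orbits do not decrease
with the index, so
[mdist x y <= mdist (s x k.+1) (s y k.+1)], which is almost
[mdist (f x) (f y)]. *)
Lemma surjective_non_expansive_isometry X (f : X -> X) :
  compact [set: X] -> set_surj setT setT f -> non_expansive f ->
  forall x y, mdist (f x) (f y) = mdist x y.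
Proof.
move=> cX sf nf x y; apply/eqP; rewrite eq_le nf/=; apply/ler_addgt0Pr => e e0.
have [g fgK] := surjective_section sf.
pose s z k := if k is k'.+1 then iter k' g z else f z.
have fs z k : f (s z k.+1) = s z k by case: k => //= k; rewrite fgK.
have iterfs z k m : iter m f (s z (m + k)%N) = s z k.
  by elim: m => // m IH; rewrite addSn iterSr fs.
have nfi m u v : mdist (iter m f u) (iter m f v) <= mdist u v.
  by elim: m => // m IH; exact: le_trans (nf _ _) IH.
have [[p q] [_ clpq]] : ([set: X] `*` [set: X]) `&`
    cluster ((fun k => (s x k, s y k)) @ \oo) !=set0.
  by apply: (compact_setX cX cX); apply: filterE => k; split.
have B : nbhs (p, q) (ball p (e / 2 / 2) `*` ball q (e / 2 / 2)).
  exists (ball p (e / 2 / 2), ball q (e / 2 / 2)) => //.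
  by split; apply: nbhsx_ballx; rewrite !divr_gt0.
have near N : exists2 k, (N <= k)%N &
    mdist p (s x k) < e / 2 / 2 /\ mdist q (s y k) < e / 2 / 2.
  have [|_ [[k Nk <-] [/=]]] :=
    clpq [set (s x k, s y k) | k in [set k | N <= k]%N] _ _ B.
    by exists N => // k Nk; exists k.
  by rewrite !ballEmdist/= => *; exists k.
have [m _ [pm qm]] := near 0%N; have [n mn [pn qn]] := near m.+1.
have close (c u v : X) : mdist c u < e / 2 / 2 -> mdist c v < e / 2 / 2 ->
    mdist u v <= e / 2.
  move=> cu cv; apply: le_trans (metric_triangle _ c _) _.
  by rewrite (splitr (e / 2)) lerD// ltW// metric_sym.
have {pm pn} mnx := close _ _ _ pm pn; have {qm qn} mny := close _ _ _ qm qn.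
pose k := (n - m.+1)%N; have nE : n = (m + k.+1)%N by rewrite addnS -addSn subnKC.
have xk : mdist (f x) (s x k.+1) <= e / 2.
  apply: le_trans mnx; rewrite nE -(iterfs x k.+1 m).
  by rewrite -{1}[f x]/(s x 0%N) -{1}(iterfs x 0%N m) addn0 nfi.
have yk : mdist (f y) (s y k.+1) <= e / 2.
  apply: le_trans mny; rewrite nE -(iterfs y k.+1 m).
  by rewrite -{1}[f y]/(s y 0%N) -{1}(iterfs y 0%N m) addn0 nfi.
have xyk : mdist x y <= mdist (s x k.+1) (s y k.+1).
  have := nfi k (s x (k + 1)%N) (s y (k + 1)%N).
  by rewrite !iterfs addn1.
apply: le_trans xyk _; apply: le_trans (metric_triangle _ (f x) _) _.
rewrite metric_sym (splitr e) [leRHS]addrCA; apply: lerD => //.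
by apply: le_trans (metric_triangle _ (f y) _) _; rewrite lerD.
Qed.

End MetricLimits.

(** * Quotient of a compact metric group by a left-invariant pseudometric *)

Section QuotientGroup.
Local Open Scope quotient_scope.
Variables (R : realType) (K : compactMetricGroupType R) (q : K -> K -> R).
Hypothesis q_le : forall x y, q x y <= mdist x y.
Hypothesis qxx : forall x, q x x = 0.
Hypothesis q_sym : forall x y, q x y = q y x.
Hypothesis q_triangle : forall y x z, q x z <= q x y + q y z.
Hypothesis q_mulgl : forall z x y, q (z * x)%g (z * y)%g = q x y.
(* With left invariance, this makes the kernel of [q] a normal subgroup. *)
Hypothesis q0_mulgr : forall z x y, q x y = 0 -> q (x * z)%g (y * z)%g = 0.

Let q_ge0 x y : 0 <= q x y.
Proof.
rewrite -(@pmulrn_lge0 _ _ 2)// -(qxx x).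
by apply: le_trans (q_triangle y x x) _; rewrite (q_sym y) mulr2n.
Qed.

Let q0_trans y x z : q x y = 0 -> q y z = 0 -> q x z = 0.
Proof.
move=> xy yz; apply/eqP; rewrite eq_le q_ge0 andbT.
by apply: le_trans (q_triangle y x z) _; rewrite xy yz addr0.
Qed.

Let same x y := q x y == 0.

Let same_equiv : equiv_class_of same.
Proof.
split=> [x|x y|y x z]; rewrite /same; first by rewrite qxx.
  by rewrite q_sym.
by move=> /eqP xy /eqP yz; rewrite (q0_trans xy yz).
Qed.

Let sameE := EquivRelPack same_equiv.

Let Q : Type := {eq_quot sameE}.
HB.instance Definition _ := Choice.on Q.

Let p (x : K) : Q := \pi_({eq_quot sameE}) x.
Let rep (a : Q) : K := repr (a : {eq_quot sameE}).

Let repK a : p (rep a) = a. Proof. exact: reprK. Qed.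

Let pP x y : p x = p y <-> q x y = 0.
Proof.
by split=> [/eqmodP/eqP//|xy]; apply/eqmodP; rewrite /= /same xy.
Qed.

Let qrep x : q (rep (p x)) x = 0.
Proof. by apply/pP; rewrite repK. Qed.

Let mulQ a b := p (rep a * rep b)%g.
Let invQ a := p (rep a)^-1%g.

Let q0_mulg x x' y y' : q x x' = 0 -> q y y' = 0 -> q (x * y)%g (x' * y')%g = 0.
Proof.
move=> xx yy; apply: (@q0_trans (x' * y)%g); first exact: q0_mulgr.
by rewrite q_mulgl.
Qed.

Let q0_invg x y : q x y = 0 -> q x^-1%g y^-1%g = 0.
Proof.
move=> /(q0_mulgr y^-1%g); rewrite -(q_mulgl x^-1%g) mulgA mulVg mul1g mulgV.
by rewrite mulg1 q_sym.
Qed.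

Let p_mul x y : p (x * y)%g = mulQ (p x) (p y).
Proof. by apply/pP; rewrite q_sym; apply: q0_mulg. Qed.

Let p_inv x : p x^-1%g = invQ (p x).
Proof. by apply/pP; rewrite q_sym; apply: q0_invg. Qed.

Let mulQA : associative mulQ.
Proof.
by move=> a b c; rewrite -(repK a) -(repK b) -(repK c) -!p_mul mulgA.
Qed.
Let mul1Q : left_id (p 1%g) mulQ.
Proof. by move=> a; rewrite -(repK a) -p_mul mul1g. Qed.
Let mulQ1 : right_id (p 1%g) mulQ.
Proof. by move=> a; rewrite -(repK a) -p_mul mulg1. Qed.
Let mulVQ : left_inverse (p 1%g) invQ mulQ.
Proof. by move=> a; rewrite -(repK a) -p_inv -p_mul mulVg. Qed.
Let mulQV : right_inverse (p 1%g) invQ mulQ.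
Proof. by move=> a; rewrite -(repK a) -p_inv -p_mul mulgV. Qed.

HB.instance Definition _ := isGroup.Build Q mulQA mul1Q mulQ1 mulVQ mulQV.

Let p_hom : group_hom p. Proof. exact: p_mul. Qed.

Let distQ a b := q (rep a) (rep b).

Let distQ_p x y : distQ (p x) (p y) = q x y.
Proof.
suff le x1 x2 y1 y2 : q x1 x2 = 0 -> q y1 y2 = 0 -> q x1 y1 <= q x2 y2.
  by apply/eqP; rewrite eq_le !le// q_sym.
move=> x12 y12; apply: le_trans (q_triangle x2 x1 y1) _; rewrite x12 add0r.
by apply: le_trans (q_triangle y2 x2 y1) _; rewrite (q_sym y2) y12 addr0.
Qed.

Let distQxx a : distQ a a = 0. Proof. exact: qxx. Qed.
Let distQ_eq0 a b : distQ a b = 0 -> a = b.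
Proof. by move=> /pP; rewrite !repK. Qed.
Let distQ_sym a b : distQ a b = distQ b a. Proof. exact: q_sym. Qed.
Let distQ_triangle b a c : distQ a c <= distQ a b + distQ b c.
Proof. exact: q_triangle. Qed.

HB.instance Definition _ :=
  isMetric.Build R Q distQxx distQ_eq0 distQ_sym distQ_triangle.

Let mdistQ_p x y : mdist (p x) (p y) = q x y. Proof. exact: distQ_p. Qed.

Let p_continuous : continuous p.
Proof. by apply: non_expansive_continuous => x y; rewrite mdistQ_p. Qed.

Let p_surj : set_surj setT setT p.
Proof. by move=> a _; exists (rep a) => //; exact: repK. Qed.

Let mdistQ_mulgl (c a b : Q) : mdist (c * a)%g (c * b)%g = mdist a b.
Proof.
by rewrite -(repK a) -(repK b) -(repK c) -!p_hom !mdistQ_p q_mulgl.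
Qed.

(* Right translations are in general not isometries for [q]; their continuity
   comes from the compactness of [K]. *)
Let mulQr_continuous (b : Q) : continuous (fun a : Q => (a * b)%g).
Proof.
apply: (@continuous_factor _ _ _ p) => //; first exact: metric_group_compact.
  exact: metric_hausdorff.
have -> : (fun a : Q => (a * b)%g) \o p = p \o (fun x => (x * rep b)%g).
  by apply/funext => x /=; rewrite p_hom repK.
move=> x; apply: continuous_comp; last exact: p_continuous.
apply: (@continuous_comp _ _ _ (fun x => (x, rep b)) (fun xy => (xy.1 * xy.2)%g)).
  by apply: cvg_pair => //=; exact: cvg_cst.
exact: mulg_continuous.
Qed.

(* For a left-invariant metric, joint continuity of the product and continuity
   of the inverse both reduce to continuity of the right translations:
   [mdist (a * b) (a' * b') <= mdist (a * b) (a' * b) + mdist b b'] and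
   [mdist a^-1 b^-1 = mdist (b * a^-1) 1]. *)
Let mulQ_continuous : continuous (fun ab : Q * Q => (ab.1 * ab.2)%g).
Proof.
move=> [a b]; apply/(mdist_cvgP (nbhs_filter (a, b))) => e e0.
have e20 : 0 < e / 2 by rewrite divr_gt0.
have /continuous_mdistP/(_ a _ e20) near_a := @mulQr_continuous b.
have /continuous_mdistP/(_ b _ e20) near_b : continuous (@id Q).
  by move=> ?; exact: cvg_id.
exists ([set a' | mdist (a * b)%g (a' * b)%g < e / 2], [set b' | mdist b b' < e / 2]).
  by split.
move=> [a' b'] [/= aa bb]; apply: le_lt_trans (metric_triangle _ (a' * b)%g _) _.
by rewrite mdistQ_mulgl [e]splitr ltrD.
Qed.

Let invQ_continuous : continuous (fun a : Q => a^-1%g).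
Proof.
apply/continuous_mdistP => a e e0.
have /continuous_mdistP/(_ a _ e0) := @mulQr_continuous a^-1%g.
apply: filterS => b; rewrite mulgV => lt_e.
by rewrite metric_sym -(mdistQ_mulgl b) mulgV.
Qed.

Let Q_compact : compact [set: Q].
Proof.
have -> : [set: Q] = p @` [set: K].
  by apply/seteqP; split => // a _; have [x] := p_surj (I : setT a); exists x.
apply: continuous_compact; last exact: metric_group_compact.
exact: continuous_subspaceT.
Qed.

HB.instance Definition _ :=
  isMetricGroup.Build R Q mulQ_continuous invQ_continuous mdistQ_mulgl.
HB.instance Definition _ := MetricGroup_isCompact.Build R Q Q_compact.

(** The closed normal subgroup divided out is the kernel of [q]; compactness
passes to the quotient because the projection is non-expansive. *)
Lemma quotient_by_pseudometric :
  exists (A : compactMetricGroupType R) (pi : K -> A),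
    [/\ group_hom pi, set_surj setT setT pi
      & forall x y, mdist (pi x) (pi y) = q x y].
Proof. by exists Q, p; split. Qed.

End QuotientGroup.

(** * The trivial group *)

(** The parameter [R] makes the metric structure inferable from the type. *)
Definition trivial_group (R : realType) : Type := unit.

Section TrivialGroup.
Variable R : realType.

HB.instance Definition _ := Choice.on (trivial_group R).

Let one : trivial_group R := tt.
Let mul (x y : trivial_group R) := one.
Let inv (x : trivial_group R) := one.

Let mulA : associative mul. Proof. by []. Qed.
Let mul1x : left_id one mul. Proof. by case. Qed.
Let mulx1 : right_id one mul. Proof. by case. Qed.
Let mulVx : left_inverse one inv mul. Proof. by []. Qed.
Let mulxV : right_inverse one inv mul. Proof. by []. Qed.

HB.instance Definition _ :=
  isGroup.Build (trivial_group R) mulA mul1x mulx1 mulVx mulxV.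

Let dist (x y : trivial_group R) : R := 0.

Let distxx x : dist x x = 0. Proof. by []. Qed.
Let dist_eq0 x y : dist x y = 0 -> x = y. Proof. by case: x y => -[]. Qed.
Let dist_sym x y : dist x y = dist y x. Proof. by []. Qed.
Let dist_triangle y x z : dist x z <= dist x y + dist y z.
Proof. by rewrite /dist addr0. Qed.

HB.instance Definition _ :=
  isMetric.Build R (trivial_group R) distxx dist_eq0 dist_sym dist_triangle.

Let to_trivial_continuous (X : topologicalType) (f : X -> trivial_group R) :
  continuous f.
Proof.
have -> : f = fun=> one by apply/funext => x; case: (f x).
by move=> x; exact: cvg_cst.
Qed.

Let mdist_mull (z x y : trivial_group R) : mdist (z * x)%g (z * y)%g = mdist x y.
Proof. by []. Qed.

HB.instance Definition _ := isMetricGroup.Build R (trivial_group R)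
  (@to_trivial_continuous _ _) (@to_trivial_continuous _ _) mdist_mull.

Let trivial_compact : compact [set: trivial_group R].
Proof.
have -> : [set: trivial_group R] = [set one] by apply/seteqP; split => -[].
exact: compact_set1.
Qed.

HB.instance Definition _ :=
  MetricGroup_isCompact.Build R (trivial_group R) trivial_compact.

End TrivialGroup.
(** * Existence of the limit *)

Section Limits.
Variables (R : realType) (d : Order.disp_t) (S : preorderType d).
Variable G : S -> compactMetricGroupType R.

(** This cocone makes the sets of distances below nonempty, so that their
supremum is a least upper bound. *)
Lemma trivial_cocone (alpha : arrows G) :
  cocone alpha (fun s (_ : G s) => 1%g : trivial_group R).
Proof.
by split=> [s|//]; split=> x y; rewrite ?mulg1 ?mdistxx ?mdist_ge0.
Qed.

Lemma non_expansive_hom_comp (A B C : compactMetricGroupType R)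
    (f : A -> B) (g : B -> C) :
  non_expansive_hom f -> non_expansive_hom g -> non_expansive_hom (g \o f).
Proof.
move=> [fM fd] [gM gd]; split=> x y /=; first by rewrite fM gM.
exact: le_trans (gd _ _) (fd _ _).
Qed.

Lemma non_expansive_hom_id (A : compactMetricGroupType R) :
  non_expansive_hom (@id A).
Proof. by split. Qed.

Section Existence.
Variables (alpha : arrows G) (s0 : S).
Hypothesis S_directed : upward_directed S.
Hypothesis alpha_surj : surjective_arrows alpha.

Let cocone_dists (x y : G s0) : set R :=
  [set r | exists (A : compactMetricGroupType R) (xi : forall s, G s -> A),
    cocone alpha xi /\ r = mdist (xi s0 x) (xi s0 y)].

Let q x y := sup (cocone_dists x y).

Let q_ub (A : compactMetricGroupType R) (xi : forall s, G s -> A) x y :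
  cocone alpha xi -> mdist (xi s0 x) (xi s0 y) <= q x y.
Proof.
move=> xiP; apply: ub_le_sup; last by exists A, xi.
by exists (mdist x y) => _ [B [z [[/(_ s0)[_ zd] _] ->]]]; exact: zd.
Qed.

Let q_lub x y r :
  (forall (A : compactMetricGroupType R) (xi : forall s, G s -> A),
    cocone alpha xi -> mdist (xi s0 x) (xi s0 y) <= r) ->
  q x y <= r.
Proof.
move=> le_r; apply: sup_le_ub => [|_ [A [xi [xiP ->]]]]; last exact: le_r.
by eexists; exists (trivial_group R), (fun s (_ : G s) => 1%g); split;
  first exact: trivial_cocone.
Qed.

Let q_ge0 x y : 0 <= q x y.
Proof. exact: le_trans (mdist_ge0 _ _) (q_ub _ _ (trivial_cocone alpha)). Qed.

(* Elements at pseudodistance zero are those that no cocone separates; hence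
   the kernel of [q] is an intersection of normal subgroups. *)
Let q0P x y : q x y = 0 <->
  forall (A : compactMetricGroupType R) (xi : forall s, G s -> A),
    cocone alpha xi -> xi s0 x = xi s0 y.
Proof.
split=> [q0 A xi xiP|xi_eq].
  by apply: mdist_positivity; apply/eqP; rewrite eq_le mdist_ge0 -q0 q_ub.
apply/eqP; rewrite eq_le q_ge0 andbT; apply: q_lub => A xi xiP.
by rewrite (xi_eq _ _ xiP) mdistxx.
Qed.

Let q_le x y : q x y <= mdist x y.
Proof. by apply: q_lub => A xi [/(_ s0)[_ xid] _]; exact: xid. Qed.

Let qxx x : q x x = 0. Proof. by apply/q0P. Qed.

Let q_sym x y : q x y = q y x.
Proof.
suff le u v : q u v <= q v u by apply/eqP; rewrite eq_le !le.
by apply: q_lub => A xi xiP; rewrite metric_sym; exact: q_ub.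
Qed.

Let q_triangle y x z : q x z <= q x y + q y z.
Proof.
apply: q_lub => A xi xiP; apply: le_trans (metric_triangle _ (xi s0 y) _) _.
by rewrite lerD// q_ub.
Qed.

Let q_mulgl z x y : q (z * x)%g (z * y)%g = q x y.
Proof.
apply/eqP; rewrite eq_le; apply/andP; split; apply: q_lub => A xi xiP;
  have [/(_ s0)[xiM _] _] := xiP.
  by rewrite !xiM mdist_mulgl q_ub.
by rewrite -(mdist_mulgl (xi s0 z)) -!xiM q_ub.
Qed.

Let q0_mulgr z x y : q x y = 0 -> q (x * z)%g (y * z)%g = 0.
Proof.
move=> /q0P xy; apply/q0P => A xi xiP; have [/(_ s0)[xiM _] _] := xiP.
by rewrite !xiM (xy _ _ xiP).
Qed.

(* This is where surjectivity of the arrows enters: [x] is moved up to a common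
   upper bound of [s] and [t] and then lifted to [G t]. *)
Let transfer s t (x : G s) : exists y : G t,
  forall (A : compactMetricGroupType R) (xi : forall s, G s -> A),
    cocone alpha xi -> xi t y = xi s x.
Proof.
have [u [su tu]] := S_directed s t.
have [y _ xy] := alpha_surj tu (I : setT (alpha su x)).
by exists y => A xi [_ xiC]; rewrite -(xiC _ _ tu) -(xiC _ _ su) /= xy.
Qed.

(** The limit is the quotient of [G s0] by the supremum pseudometric [q].  An
element [x] of [G s] is sent to the class of any [y] in [G s0] such that
[xi s0 y = xi s x] for all cocones [xi]. *)
Lemma surjective_inductive_limit_exists :
  exists (A : compactMetricGroupType R) (a : forall s, G s -> A),
    inductive_limit alpha a /\ forall s, set_surj setT setT (a s).
Proof.
have [A [p [pM p_surj pd]]] :=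
  quotient_by_pseudometric q_le qxx q_sym q_triangle q_mulgl q0_mulgr.
have p_eq x y : (forall (B : compactMetricGroupType R) (xi : forall s, G s -> B),
    cocone alpha xi -> xi s0 x = xi s0 y) -> p x = p y.
  by move=> /q0P; rewrite -pd; exact: mdist_positivity.
pose tr s (x : G s) : G s0 := projT1 (cid (transfer s0 x)).
have trP s x (B : compactMetricGroupType R) (xi : forall s, G s -> B) :
  cocone alpha xi -> xi s0 (tr s x) = xi s x by rewrite /tr; case: cid => y; exact.
pose a s x := p (tr s x).
have aE s (x : G s) y : (forall (B : compactMetricGroupType R)
    (xi : forall s, G s -> B), cocone alpha xi -> xi s0 y = xi s x) -> a s x = p y.
  by move=> yx; apply: p_eq => B xi xiP; rewrite trP// yx.
have aP : cocone alpha a.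
  split=> [s|s t st]; first split=> x y.
  - rewrite -pM; apply: aE => B xi xiP; have [/(_ _)/proj1 xiM _] := xiP.
    by rewrite !xiM !trP.
  - rewrite pd; apply: q_lub => B xi xiP; rewrite !trP//.
    by have [/(_ s)/proj2 xid _] := xiP; exact: xid.
  apply/funext => x /=; apply: aE => B xi xiP; rewrite trP//.
  by have [_ xiC] := xiP; rewrite -(xiC _ _ st).
have as0 x : a s0 x = p x by exact: aE.
exists A, a; split; last first.
  move=> s z _; have [y _ <-] := p_surj z I; have [x yx] := transfer s y.
  by exists x => //; apply: aE => B xi xiP; rewrite yx.
split=> // B xi xiP; have [xi_hom xiC] := xiP.
have [r pK] := surjective_section p_surj.
pose nu z := xi s0 (r z).
have nuE x : nu (p x) = xi s0 x.
  have /q0P rpx : q (r (p x)) x = 0 by rewrite -pd pK mdistxx.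
  exact: rpx.
have nua s (x : G s) : nu (a s x) = xi s x by rewrite nuE trP.
exists nu; split; first split; first split=> z1 z2.
- rewrite -(pK z1) -(pK z2) -pM !nuE; exact: (proj1 (xi_hom s0)).
- by rewrite -[in leRHS](pK z1) -[in leRHS](pK z2) pd q_ub.
- by move=> s; apply/funext => x; exact: nua.
move=> nu' [_ nu'a]; apply/funext => z; rewrite -(pK z) nuE -as0.
by rewrite -(nu'a s0).
Qed.

End Existence.

Lemma empty_inductive_limit (alpha : arrows G) :
  (S -> False) ->
  inductive_limit alpha (fun s (_ : G s) => 1%g : trivial_group R).
Proof.
move=> S0; split=> [|B xi _]; first exact: trivial_cocone.
exists (fun=> 1%g); split=> [|nu [[nuM _] _]].
  split; last by move=> s; have := S0 s.
  by split=> x y; rewrite ?mulg1 ?mdistxx ?mdist_ge0.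
apply/funext => -[].
have nu_idem : nu tt = (nu tt * nu tt)%g := nuM tt tt.
by apply: (mulgI (nu tt)); rewrite -nu_idem mulg1.
Qed.

(** * Uniqueness of the limit and surjectivity of its arrows *)

Lemma inductive_limit_endo_id (alpha : arrows G) (A : compactMetricGroupType R)
    (a : forall s, G s -> A) (h : A -> A) :
  inductive_limit alpha a -> non_expansive_hom h ->
  (forall s, h \o a s = a s) -> h =1 id.
Proof.
move=> [aP a_univ] h_hom ha x; have [nu [_ nu_uniq]] := a_univ _ _ aP.
rewrite -(nu_uniq h)// (nu_uniq id)//.
by split=> //; exact: non_expansive_hom_id.
Qed.

Lemma inductive_limit_unique (alpha : arrows G) (A B : compactMetricGroupType R)
    (a : forall s, G s -> A) (b : forall s, G s -> B) :
  inductive_limit alpha a -> inductive_limit alpha b ->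
  exists (f : A -> B) (g : B -> A), [/\ non_expansive_hom f,
    non_expansive_hom g, cancel f g, cancel g f & forall s, f \o a s = b s].
Proof.
move=> aL bL; have [aP a_univ] := aL; have [bP b_univ] := bL.
have [f [[f_hom fa] _]] := a_univ _ _ bP.
have [g [[g_hom gb] _]] := b_univ _ _ aP.
exists f, g; split=> //;
  [apply: (inductive_limit_endo_id aL) | apply: (inductive_limit_endo_id bL)];
  do ?[exact: non_expansive_hom_comp] => s; by rewrite -compA ?fa ?gb ?fa.
Qed.

Lemma non_expansive_inverses_isometric (A B : compactMetricGroupType R)
    (f : A -> B) (g : B -> A) :
  non_expansive_hom f -> non_expansive g -> cancel f g -> cancel g f ->
  isometrically_isomorphic A B.
Proof.
move=> [fM fd] gd fK gK; exists f; split=> // [|x y]; first by exists g.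
by apply/eqP; rewrite eq_le fd -[in leLHS](fK x) -[in leLHS](fK y) gd.
Qed.

Section SurjectiveSystem.
Variable alpha : arrows G.
Hypothesis S_directed : upward_directed S.
Hypothesis alpha_system : direct_system alpha.
Hypothesis alpha_surj : surjective_arrows alpha.

Lemma inductive_limit_surjective (A : compactMetricGroupType R)
    (a : forall s, G s -> A) :
  inductive_limit alpha a -> forall s, set_surj setT setT (a s).
Proof.
move=> aL s z _.
have [B [b [bL b_surj]]] := surjective_inductive_limit_exists s S_directed alpha_surj.
have [f [g [_ _ fK gK fb]]] := inductive_limit_unique bL aL.
by have [x _ xz] := b_surj s (g z) I; exists x => //; rewrite -fb /= xz gK.
Qed.

(** * Independence of the arrows *)

Lemma tail_ultrafilter (s0 : S) : exists U : set_system S,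
  UltraFilter U /\ forall s, U [set t | (s <= t)%O].
Proof.
pose F := filter_from [set: S] (fun s => [set t | (s <= t)%O]).
have FF : ProperFilter F.
  apply: filter_from_proper; last by move=> s _; exists s => /=.
  apply: filter_from_filter; first by exists s0.
  move=> s t _ _; have [u [su tu]] := S_directed s t.
  by exists u => // v /= uv; split; exact: le_trans uv.
have [U [UU FU]] := ultraFilterLemma FF.
by exists U; split=> // s; apply: FU; exists s.
Qed.

(** The limit of the maps [b u \o alpha s u] along an ultrafilter of indices [u]
is compatible with [alpha], since for [s <= t] the maps [b u \o alpha s u] and
[b u \o alpha t u \o alpha s t] agree for all [u] above [t].  It is again
surjective: preimages of a point [z] under these maps converge in the compact
group [G s0], and by non-expansiveness the limit map sends their limit to
[z]. *)
Lemma surjection_from_limit (s0 : S) (A B : compactMetricGroupType R)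
    (a : forall s, G s -> A) (b : forall s, G s -> B) :
  inductive_limit alpha a ->
  (forall s, non_expansive_hom (b s)) ->
  (forall s, set_surj setT setT (b s)) ->
  exists f : A -> B, non_expansive_hom f /\ set_surj setT setT f.
Proof.
move=> [aP a_univ] b_hom b_surj.
have [alpha_hom _ alpha_comp] := alpha_system.
have [U [UU U_tail]] := tail_ultrafilter s0.
have UP : ProperFilter U by exact: ultra_proper.
(* The value [1] outside the final segment of [s] is arbitrary: the ultrafilter
   does not see it. *)
pose h s (x : G s) t : B :=
  if pselect (s <= t)%O is left st then b t (alpha st x) else 1%g.
have hE s x t (st : (s <= t)%O) : h s x t = b t (alpha st x).
  by rewrite /h; case: pselect => // st'; rewrite (bool_irrelevance st st').
have [c c_lim] : exists c : forall s, G s -> B,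
    forall s x, (h s x t @[t --> U]) --> c s x.
  have lim s x : exists p, (h s x t @[t --> U]) --> (p : B).
    by apply: ultrafilter_limit; exact: metric_group_compact.
  by exists (fun s x => projT1 (cid (lim s x))) => s x; case: cid.
have B_hausdorff : hausdorff_space B := @metric_hausdorff _ _.
have cP : cocone alpha c.
  split=> [s|s t st]; first split=> x y.
  - apply: (cvg_unique B_hausdorff (c_lim s (x * y)%g)).
    have : (fun t => h s x t * h s y t)%g @ U --> (c s x * c s y)%g.
      apply: (@cvg_comp _ _ _ (fun t => (h s x t, h s y t))
                              (fun ab => (ab.1 * ab.2)%g) U
                              (nbhs (c s x, c s y))).
        by apply: cvg_pair; exact: c_lim.
      exact: (@mulg_continuous R B (c s x, c s y)).
    apply: cvg_trans; apply: near_eq_cvg.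
    apply: filterS (U_tail s) => t st; rewrite !(hE _ _ _ st).
    by rewrite (proj1 (alpha_hom _ _ st)) (proj1 (b_hom t)).
  - apply: (mdist_limit_le UP (c_lim s x) (c_lim s y)).
    apply: filterS (U_tail s) => t st; rewrite !(hE _ _ _ st).
    exact: (proj2 (non_expansive_hom_comp (alpha_hom _ _ st) (b_hom t))).
  apply/funext => x /=; apply: (cvg_unique B_hausdorff (c_lim t _)).
  apply: cvg_trans (c_lim s x); apply: near_eq_cvg.
  apply: filterS (U_tail t) => u tu; rewrite (hE _ _ _ tu).
  by rewrite (hE _ _ _ (le_trans st tu)) -(alpha_comp _ _ _ st tu).
have [f [[f_hom fa] _]] := a_univ _ _ cP; exists f; split=> // z _.
have preimages t : exists x : G s0, forall st : (s0 <= t)%O, b t (alpha st x) = z.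
  have [st|nst] := pselect (s0 <= t)%O; last by exists 1%g.
  have [y _ yz] := b_surj t z I; have [x _ xy] := alpha_surj st (I : setT y).
  by exists x => st'; rewrite (bool_irrelevance st' st) xy.
pose x t := projT1 (cid (preimages t)).
have xE t (st : (s0 <= t)%O) : b t (alpha st (x t)) = z.
  by rewrite /x; case: cid.
have [x0 x_lim] := ultrafilter_limit x UU (@metric_group_compact R (G s0)).
exists (a s0 x0) => //; rewrite -[LHS]/((f \o a s0) x0) fa.
apply: (cvg_unique B_hausdorff (c_lim s0 x0)).
apply/(mdist_cvgP _) => e e0.
have /(mdist_cvgP _)/(_ e e0) := x_lim.
move=> /(filterI (U_tail s0)); apply: filterS => t [st].
rewrite (hE _ _ _ st) -(xE t st) metric_sym; apply: le_lt_trans.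
exact: (proj2 (non_expansive_hom_comp (alpha_hom _ _ st) (b_hom t))).
Qed.

End SurjectiveSystem.

Lemma isometric_of_surjections (A B : compactMetricGroupType R)
    (f : A -> B) (g : B -> A) :
  non_expansive_hom f -> set_surj setT setT f ->
  non_expansive_hom g -> set_surj setT setT g ->
  isometrically_isomorphic A B.
Proof.
move=> f_hom f_surj g_hom g_surj; have [fM fd] := f_hom.
have gf_iso : forall x y, mdist (g (f x)) (g (f y)) = mdist x y.
  apply: (@surjective_non_expansive_isometry _ _ (g \o f)).
  - exact: metric_group_compact.
  - move=> z _; have [y _ <-] := g_surj z I; have [x _ <-] := f_surj y I.
    by exists x.
  - exact: (proj2 (non_expansive_hom_comp f_hom g_hom)).
have f_iso x y : mdist (f x) (f y) = mdist x y.
  by apply/eqP; rewrite eq_le fd -gf_iso (proj2 g_hom).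
have f_inj : injective f.
  by move=> x y xy; apply: mdist_positivity; rewrite -f_iso xy mdistxx.
have [r rK] := surjective_section f_surj.
by exists f; split=> //; exists r => // x; apply: f_inj; rewrite rK.
Qed.

End Limits.

Theorem theorem4p2 (R : realType) (d : Order.disp_t) (S : preorderType d)
    (G : S -> compactMetricGroupType R) (alpha : arrows G) :
  upward_directed S ->
  direct_system alpha ->
  surjective_arrows alpha ->
  [/\ exists (A : compactMetricGroupType R) (a : forall s : S, G s -> A),
        inductive_limit alpha a,
      forall beta : arrows G,
        direct_system beta -> surjective_arrows beta ->
        forall (A B : compactMetricGroupType R)
               (a : forall s : S, G s -> A) (b : forall s : S, G s -> B),
          inductive_limit alpha a -> inductive_limit beta b ->
          isometrically_isomorphic A B
    & forall (A : compactMetricGroupType R) (a : forall s : S, G s -> A),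
        inductive_limit alpha a ->
        forall s : S, set_surj setT setT (a s)].
Proof.
move=> S_dir alpha_sys alpha_surj.
split; last exact: inductive_limit_surjective.
  have [[s0 _]|S0] := pselect (exists s : S, True).
    have [A [a [aL _]]] := surjective_inductive_limit_exists s0 S_dir alpha_surj.
    by exists A, a.
  exists (trivial_group R); eexists; apply: empty_inductive_limit => s.
  by apply: S0; exists s.
move=> beta beta_sys beta_surj A B a b aL bL.
have [[s0 _]|S0] := pselect (exists s : S, True).
  have [f [f_hom f_surj]] := surjection_from_limit S_dir alpha_sys alpha_surj s0
    aL (proj1 (proj1 bL)) (inductive_limit_surjective S_dir beta_surj bL).
  have [g [g_hom g_surj]] := surjection_from_limit S_dir beta_sys beta_surj s0
    bL (proj1 (proj1 aL)) (inductive_limit_surjective S_dir alpha_surj aL).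
  exact: isometric_of_surjections f_hom f_surj g_hom g_surj.
have alpha_beta : alpha = beta.
  by apply/functional_extensionality_dep => s; case: S0; exists s.
rewrite -alpha_beta in bL.
have [f [g [f_hom [_ gd] fK gK _]]] := inductive_limit_unique aL bL.
exact: non_expansive_inverses_isometric f_hom gd fK gK.
Qed.
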